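(* Let $\mathcal{M}$ be the maximal robust positively invariant set contained in $G$ of the constrained system $\dot{x}(t)=f(x(t),d(t))$, $x(t_0)=x_0$, $d\in\mathcal{D}$, $g_i(x(t))\le 0$ for all $t\in[t_0,\infty)$, $i=1,\dots,p$. Assume: (A1) $\mathcal{D}$ is the set of all Lebesgue measurable functions mapping $[t_0,\infty)$ to a set $D\subset\mathbb{R}^m$ which is compact and convex. (A2) $f$ is $C^2$ with respect to $d\in D$, and for every $d$ in an open subset containing $D$, $f$ is $C^2$ with respect to $x\in\mathbb{R}^n$. (A3) Every $x_0$ with $\|x_0\|<\infty$ and every $d\in\mathcal{D}$ admits a unique absolutely continuous integral curve of the system that remains bounded over any finite time interval. (A4) The set $f(x,D)=\{f(x,d): d\in D\}$ is convex for all $x\in\mathbb{R}^n$. (A5) For every $i$ the function $g_i$ is $C^2$ with respect to $x\in\mathbb{R}^n$, and the set $\{x: g_i(x)=0\}$ defines a manifold. Then $\mathcal{M}$ is closed.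
   Context: Setting: $x(t)\in\mathbb{R}^n$ is the state and $d(t)\in\mathbb{R}^m$ is a disturbance. $x^{(d,x_0,t_0)}$ is the solution of $\dot{x}(t)=f(x(t),d(t))$ with initial condition $x_0$ at time $t_0$ and disturbance realisation $d\in\mathcal{D}$, and $x^{(d,x_0,t_0)}(t)$ is its value at time $t\in[t_0,\infty)$. $G=\{x\in\mathbb{R}^n: g_i(x)\le 0,\ i=1,\dots,p\}$. Definition: a set $\Omega\subset\mathbb{R}^n$ is a robust positively invariant set (RPI) of the system if $x^{(d,x_0,t_0)}(t)\in\Omega$ for all $t\in[t_0,\infty)$, all $x_0\in\Omega$ and all $d\in\mathcal{D}$. The maximal robust positively invariant set $\mathcal{M}$ contained in $G$ is the union of all RPIs that are subsets of $G$. *)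

(* Defs.v *)
(* The real numbers are an arbitrary [R : realType]; $\mathbb{R}^n$ is the type
   of column vectors ['cV[R]_n]. *)
From HB Require Import structures.
From mathcomp Require Export all_boot all_order all_algebra.
From mathcomp Require Export all_classical all_reals all_analysis.
From mathcomp Require Export measurable_realfun.
Export numFieldNormedType.Exports.
Set Implicit Arguments.
Unset Strict Implicit.
Unset Printing Implicit Defensive.
Export Order.TTheory GRing.Theory Num.Theory.
Local Open Scope classical_set_scope.
Local Open Scope ring_scope.

(* [F] is C^k on the open set [U] with respect to the directions in [S]: all
   iterated directional derivatives of order at most [k], along vectors of [S],
   exist and are continuous at every point of [U].  For [S = setT] and [V]
   finite-dimensional this is C^k on [U] in the usual sense.  For a product
   [V = X * Y], taking [S = X * 0] gives "C^k with respect to the variable of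
   X", the partial derivatives being continuous jointly in both variables. *)
Fixpoint Ck_along (R : realType) (V W : normedModType R) (k : nat)
    (S U : set V) (F : V -> W) : Prop :=
  (forall z, U z -> {for z, continuous F}) /\
  (if k is k'.+1 then
     forall v, S v ->
       (forall z, U z -> derivable F z v) /\ Ck_along k' S U ('D_v F)
   else True).

(* A topological manifold (Hausdorff and second countable as a subset of R^n)
   of some dimension [k]; [phi] and [psi] are mutually inverse homeomorphisms
   between a relatively open neighbourhood in [S] and an open subset of R^k. *)
Definition is_manifold (R : realType) (n : nat) (S : set 'cV[R]_n) : Prop :=
  exists k : nat, forall x, S x ->
    exists (U : set 'cV[R]_n) (V : set 'cV[R]_k)
           (phi : 'cV[R]_n -> 'cV[R]_k) (psi : 'cV[R]_k -> 'cV[R]_n),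
      [/\ open_nbhs x U, open V,
          (forall y, (S `&` U) y -> V (phi y) /\ psi (phi y) = y),
          (forall v, V v -> (S `&` U) (psi v) /\ phi (psi v) = v) &
          {within S `&` U, continuous phi} /\ {within V, continuous psi}].

Definition abs_continuous_on (R : realType) (V : normedModType R)
    (a b : R) (x : R -> V) : Prop :=
  forall e : R, 0 < e -> exists2 delta : R, 0 < delta &
    forall (N : nat) (l r : 'I_N -> R),
      (forall i, [/\ a <= l i, l i <= r i & r i <= b]) ->
      trivIset setT (fun i => `]l i, r i[%classic) ->
      \sum_(i < N) (r i - l i) < delta ->
      \sum_(i < N) `|x (r i) - x (l i)| < e.

(* The real line with its Lebesgue (completed Borel) sigma-algebra. *)
Definition lebesgueType (R : realType) :=
  g_sigma_algebraType (completed_algebra_gen (@lebesgue_measure R)).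

Definition borel_cV (R : realType) (m : nat) :=
  g_sigma_algebraType (@open 'cV[R]_m).

(* Lebesgue measurable functions [t0, +oo) -> D, represented by total functions
   whose values before [t0] are irrelevant. *)
Definition disturbances (R : realType) (m : nat) (t0 : R) (D : set 'cV[R]_m) :
    set (R -> 'cV[R]_m) :=
  [set d | @measurable_fun _ _ (lebesgueType R) (borel_cV R m)
             `[t0, +oo[%classic d
           /\ forall t, t0 <= t -> D (d t)].

Section System.
Context (R : realType) (n m : nat).
Variables (f : 'cV[R]_n -> 'cV[R]_m -> 'cV[R]_n) (t0 : R) (D : set 'cV[R]_m).
Implicit Types (d : R -> 'cV[R]_m).

(* Only the restriction of [x] to [t0, +oo) matters. *)
Definition is_integral_curve d
    (x0 : 'cV[R]_n) (x : R -> 'cV[R]_n) : Prop :=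
  [/\ x t0 = x0,
      (forall T, t0 <= T -> abs_continuous_on t0 T x) &
      {ae lebesgue_measure,
        forall t : R, t0 < t -> is_derive t 1 x (f (x t) (d t))}].

(* The solution $x^{(d,x_0,t_0)}$, meaningful on [t0, +oo) when the integral
   curve exists and is unique there. *)
Definition solution d (x0 : 'cV[R]_n) : R -> 'cV[R]_n :=
  xget (cst x0) [set x | is_integral_curve d x0 x].

Definition RPI (Omega : set 'cV[R]_n) : Prop :=
  forall (x0 : 'cV[R]_n) d (t : R), Omega x0 -> disturbances t0 D d -> t0 <= t ->
    Omega (solution d x0 t).

Definition maximal_RPI (G : set 'cV[R]_n) : set 'cV[R]_n :=
  \bigcup_(Omega in [set Omega | RPI Omega /\ Omega `<=` G]) Omega.

End System.

Definition constraint_set (R : realType) (n p : nat)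
    (g : 'I_p -> 'cV[R]_n -> R) : set 'cV[R]_n :=
  [set x | forall i, g i x <= 0].

(* Main.v *)
From mathcomp Require Import ring lra.
Require Import Defs.
Set Implicit Arguments.
Unset Strict Implicit.
Unset Printing Implicit Defensive.
Local Open Scope classical_set_scope.
Local Open Scope ring_scope.

(** The maximal invariant set [M] is a union of invariant sets, hence invariant.
    If solutions depend continuously on the initial state, for a fixed
    disturbance [d] and a fixed time, then the closure of [M] is invariant too:
    a point [x0] of the closure is approximated by points of [M], whose
    solutions stay in [M] and converge to the solution from [x0].  The
    constraint set is closed because the [g i] are continuous, so the closure of
    [M] is an invariant subset of it, and maximality puts it inside [M].

    The work is in the continuous dependence [solutions_depend_continuously].
    The disturbance is only measurable, so the solutions are only absolutely
    continuous and solve the equation almost everywhere.  Three facts carry the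
    argument.
    - An absolutely continuous function with almost everywhere bounded
      derivative satisfies the mean value inequality
      [abs_continuous_increment_le].  It is obtained by moving from left to
      right ([real_induction]) and treating the exceptional null set through a
      small open cover.
    - The right-hand side is Lipschitz in the state near any given state,
      uniformly over the compact set of disturbance values
      [locally_lipschitz_uniformly], because its partial derivatives in the
      state are jointly continuous.
    - Hence, while one solution stays near a given state, the distance from it
      to a close enough solution at most doubles over a time interval whose
      length depends on the local Lipschitz constant
      [abs_continuous_stays_small], and real induction carries the estimate to
      any given time. *)

(** * Real induction and mean value inequalities *)

(** The supremum of the points where [P] holds is reached from the left and then
    crossed.  As the radius [e] may depend arbitrarily on [c], this plays the
    role of extracting a finite subcover, or a tagged partition finer than a
    given gauge. *)
Lemma real_induction (R : realType) (a b : R) (P : R -> Prop) :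
  a <= b -> P a ->
  (forall c, a <= c <= b -> exists2 e, 0 < e &
     forall s t, a <= s <= c -> c - e < s -> c <= t <= b -> t < c + e ->
       P s -> P t) ->
  P b.
Proof.
move=> ab Pa step.
pose E := [set t | a <= t <= b /\ P t].
have Ea : E a by rewrite /E /= lexx ab.
have supE : has_sup E by split; [exists a | exists b => t [/andP[]]].
have ac : a <= sup E by apply: (sup_upper_bound supE).
have cb : sup E <= b by apply: ge_sup; [exists a | move=> t [/andP[]]].
have [e e0 stepc] := step (sup E) (introT andP (conj ac cb)).
have [s [/andP[as_ sb] Ps] cs] := sup_adherent e0 supE.
have sc : s <= sup E by apply: (sup_upper_bound supE); split=> //; rewrite as_.
(* [c = sup E] itself and the points just after it are reached from [s]. *)
have extend t : sup E <= t <= b -> t < sup E + e -> P t.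
  by move=> ? ?; apply: (stepc s) => //; rewrite as_.
have [bc|cltb] := leP b (sup E); first
  by apply: extend; [rewrite cb lexx | lra].
pose t := Num.min b (sup E + e / 2).
have ct : sup E < t by rewrite lt_min cltb /=; lra.
have tb : t <= b by rewrite ge_min lexx.
have te : t <= sup E + e / 2 by rewrite ge_min lexx orbT.
have Pt : P t by apply: extend; [rewrite ltW | lra].
have : t <= sup E by apply: (sup_upper_bound supE); split=> //; lra.
by rewrite leNgt ct.
Qed.

(** The increment between [s] and [t] on both sides of [t0] splits at [t0] into
    two increments, and the derivative at the single point [t0] controls both.
    This is the local step of the real inductions on increments below. *)
Lemma derivative_bound_local_increment (R : realType) (V : normedModType R)
    (phi : R -> V) (t0 C e : R) (v : V) :
  is_derive t0 1 phi v -> `|v| <= C -> 0 < e ->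
  exists2 r, 0 < r & forall s t, t0 - r < s -> s <= t0 -> t0 <= t ->
    t < t0 + r -> `|phi t - phi s| <= (C + e) * (t - s).
Proof.
move=> [dphi <-] vC e0.
have := dphi; rewrite /derivable => /cvgrPdist_lt /(_ _ e0).
rewrite /= near_withinE => /nbhs_ballP[r r0 near_r].
have half h : `|h| < r -> `|phi (t0 + h) - phi t0| <= (C + e) * `|h|.
  move=> hr; have [->|h0] := eqVneq h 0.
    by rewrite addr0 subrr !normr0 mulr0.
  have := near_r h; rewrite /ball /= sub0r normrN => /(_ hr h0).
  rewrite [h *: 1]mulr1 [h + t0]addrC => q.
  (* [Q] is the difference quotient, within [e] of the derivative. *)
  set Q := _ *: _ in q.
  have -> : phi (t0 + h) - phi t0 = h *: Q by rewrite scalerA mulfV // scale1r.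
  rewrite normrZ mulrC ler_wpM2r // -[Q](subrK ('D_1 phi t0)).
  rewrite (le_trans (ler_normD _ _)) // addrC lerD // ltW // distrC.
  exact: q.
exists r => // s t rs st0 t0t tr.
have -> : phi t - phi s = (phi (t0 + (t - t0)) - phi t0)
                        - (phi (t0 + (s - t0)) - phi t0).
  by rewrite ![t0 + _]addrC !subrK opprB addrA subrK.
rewrite (le_trans (ler_normB _ _)) //.
have -> : (C + e) * (t - s) = (C + e) * `|t - t0| + (C + e) * `|s - t0|.
  by rewrite ger0_norm ?ler0_norm; [ring | lra | lra].
by rewrite lerD // half // ltr_norml; apply/andP; split; lra.
Qed.

(** Real induction along the segment gives the inequality for functions with
    values in a normed space, where the mean slope need not be a value of the
    derivative. *)
Lemma directional_increment_le (R : realType) (V W : normedModType R)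
    (F : V -> W) (x v : V) (C c : R) :
  0 <= c ->
  (forall r, 0 <= r <= c ->
     derivable F (x + r *: v) v /\ `|'D_v F (x + r *: v)| <= C) ->
  `|F (x + c *: v) - F x| <= C * c.
Proof.
move=> c0 dF; apply/ler_addgt0Pr => e e0.
have e'0 : 0 < e / (c + 1) by rewrite divr_gt0 //; lra.
pose phi (r : R^o) : W := F (x + r *: v).
have dphi r : 0 <= r <= c -> is_derive (r : R^o) 1 phi ('D_v F (x + r *: v)).
  move=> /dF[derF _].
  have quotientE :
      (fun h : R =>
         h^-1 *: ((phi \o shift (r : R^o)) (h *: (1 : R^o)) - phi r))
    = (fun h : R =>
         h^-1 *: ((F \o shift (x + r *: v)) (h *: v) - F (x + r *: v))).
    apply/funext => h /=; congr (_ *: (F _ - _)).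
    by rewrite [h *: 1]mulr1 scalerDl addrCA.
  by split; [rewrite /derivable quotientE | rewrite /derive quotientE].
suff bound : `|phi c - phi 0| <= (C + e / (c + 1)) * c.
  rewrite /phi scale0r addr0 in bound.
  rewrite (le_trans bound) // mulrDl lerD // mulrAC ler_pdivrMr; last lra.
  by apply: ler_wpM2l; lra.
apply: (@real_induction R 0 c
  (fun r => `|phi r - phi 0| <= (C + e / (c + 1)) * r)) => //.
  by rewrite subrr normr0 mulr0.
move=> r rc; have [g g0 incr] :=
  derivative_bound_local_increment (dphi r rc) (dF r rc).2 e'0.
exists g => // s t /andP[_ sr] gs /andP[rt _] tg bs.
have -> : phi t - phi 0 = (phi s - phi 0) + (phi t - phi s).
  by rewrite [RHS]addrC addrA subrK.
rewrite (le_trans (ler_normD _ _)) //.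
rewrite (le_trans (lerD bs (incr s t gs sr rt tg))) //.
by rewrite -mulrDr [s + _]addrC subrK.
Qed.

Lemma ordered_intervals_disjoint (R : realType) (N : nat) (l r : nat -> R) :
  (forall i j, (i < j < N)%N -> r i <= l j) ->
  trivIset [set: 'I_N] (fun i => `]l i, r i[%classic).
Proof.
move=> ordered; apply/trivIsetP => i j _ _ ij.
wlog {ij} ij : i j / (i < j)%N.
  move=> H; case: (ltngtP i j) => [|ji|/val_inj/eqP].
  - exact: H.
  - by rewrite setIC; exact: H.
  - by rewrite (negPf ij).
have rilj : r i <= l j by apply: ordered; rewrite ij ltn_ord.
apply/seteqP; split => z //=; rewrite !in_itv /= => -[/andP[_ zr] /andP[lz _]].
by have := lt_le_trans (lt_trans lz zr) rilj; rewrite ltxx.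
Qed.

Lemma null_set_open_cover (R : realType) (N : set R) (e : R) :
  lebesgue_measure.-negligible N -> 0 < e ->
  exists U : set R, [/\ open U, N `<=` U & (lebesgue_measure U < e%:E)%E].
Proof.
move=> [A [mA A0 NA]] e0.
have Afin : (lebesgue_measure A < +oo)%E by rewrite A0.
have [U [oU AU UA]] := lebesgue_regularity_outer mA Afin e0.
exists U; split => //; first exact: subset_trans AU.
have mU : measurable U by exact: open_measurable.
apply: le_lt_trans UA; rewrite -[leRHS]adde0 -A0.
rewrite -[X in (lebesgue_measure X <= _)%E](setDUK AU) setUC.
by rewrite measureU2 //; exact: measurableD.
Qed.

(** The exceptional null set is covered by an open set [U] of small measure.
    Moving from [a] to [b], a point outside [U] is crossed at the cost of the
    derivative bound, up to [e'], and a point of [U] by recording the crossed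
    interval, which lies in [U].  The recorded intervals are disjoint and their
    total length is at most the measure of [U], so absolute continuity makes the
    variation over them small. *)
Lemma abs_continuous_increment_le (R : realType) (V : normedModType R)
    (a b C : R) (phi : R -> V) :
  a <= b -> 0 <= C -> abs_continuous_on a b phi ->
  {ae lebesgue_measure, forall t : R, a < t < b ->
     exists2 v, is_derive t 1 phi v & `|v| <= C} ->
  `|phi b - phi a| <= C * (b - a).
Proof.
move=> ab C0 acphi dphi; apply/ler_addgt0Pr => e e0.
have [delta delta0 smallvar] := acphi (e / 2) (divr_gt0 e0 (ltr0Sn _ 1)).
(* The [+ 1] keeps the denominator positive when [a = b]. *)
pose e' := e / 2 / (b - a + 1).
have e'0 : 0 < e' by rewrite !divr_gt0 //; lra.
have negl_ab : lebesgue_measure.-negligible [set a; b].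
  exists [set a; b]; split => //.
    by apply: measurableU; exact: measurable_set1.
  by rewrite measureU0;
    do ?[exact: measurable_set1 | exact: lebesgue_measure_set1].
(* The endpoints carry no derivative bound, so they join the null set. *)
have [U [oU ZU muU]] := null_set_open_cover (negligibleU dphi negl_ab) delta0.
pose covered t := exists (N : nat) (l r : nat -> R),
  [/\ forall i, (i < N)%N -> [/\ a <= l i, l i <= r i & r i <= t],
      forall i j, (i < j < N)%N -> r i <= l j,
      ((\sum_(i < N) (r i - l i))%:E <= lebesgue_measure (U `&` `[a, t[))%E &
      `|phi t - phi a| <=
        (C + e') * (t - a) + \sum_(i < N) `|phi (r i) - phi (l i)|].
have [N [l [r [lr disj len incr]]]] : covered b.
  apply: (real_induction ab).
    exists 0, (fun=> a), (fun=> a); split => //.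
    - by rewrite big_ord0; exact: measure_ge0.
    - by rewrite !subrr normr0 mulr0 big_ord0 addr0.
  move=> c /andP[ac cb]; have [cU|ncU] := pselect (U c).
    (* The interval from [s] to [t] is appended at index [N]. *)
    move: (oU); rewrite openE => /(_ _ cU) /nbhs_ballP[g g0 gU].
    exists g => // s t /andP[as_ sc] gs /andP[ct tb] tg.
    move=> [N [l [r [lr disj len incr]]]].
    exists N.+1, (fun i => if i == N then s else l i),
      (fun i => if i == N then t else r i).
    have neqN (i : 'I_N) : (i == N :> nat) = false by rewrite ltn_eqF.
    split.
    - move=> i iN; case: eqVneq => [_|iN']; first by split => //; lra.
      have [|? ? ?] := lr i; first by rewrite ltn_neqAle iN' -ltnS.
      by split => //; lra.
    - move=> i j /andP[ij]; rewrite ltnS leq_eqVlt => /predU1P[jN|jN].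
        rewrite jN eqxx ltn_eqF -?jN //.
        by have [|] := lr i; first rewrite -jN.
      by rewrite (ltn_eqF jN) (ltn_eqF (ltn_trans ij jN)) disj // ij.
    - rewrite big_ord_recr /= eqxx.
      under eq_bigr do rewrite neqN.
      have st : s <= t by lra.
      have -> : U `&` `[a, t[ = (U `&` `[a, s[) `|` `[s, t[.
        apply/seteqP; split => z /=.
          rewrite !in_itv /= => -[Uz /andP[az zt]].
          by have [zs|sz] := ltP z s; [left; rewrite az|right; rewrite zt].
        rewrite !in_itv /= => -[[Uz /andP[az zs]]|/andP[sz zt]].
          by split => //; apply/andP; split => //; lra.
        split; last by apply/andP; split => //; lra.
        by apply: gU; rewrite /ball /= ltr_norml; apply/andP; split; lra.
      have mu_st : ((t - s)%:E <= lebesgue_measure (`[s, t[%classic : set R))%E.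
        rewrite lebesgue_measure_itv /= lte_fin.
        by case: ltP => // ts; rewrite lee_fin; lra.
      rewrite EFinD measureU //.
      + by apply: leeD => //; exact: mu_st.
      + apply: measurableI; last exact: measurable_itv.
        exact: open_measurable.
      + apply/seteqP; split => z //=; rewrite !in_itv /=.
        by move=> [[_ /andP[_ zs]] /andP[sz _]]; lra.
    - rewrite big_ord_recr /= eqxx.
      under eq_bigr do rewrite neqN.
      have -> : phi t - phi a = (phi s - phi a) + (phi t - phi s).
        by rewrite [RHS]addrC addrA subrK.
      rewrite (le_trans (ler_normD _ _)) // addrA lerD //.
      rewrite (le_trans incr) // lerD // ler_wpM2l //; lra.
  have nZ := contra_not (ZU c) ncU.
  have abc : a < c < b.
    rewrite !lt_neqAle ac cb !andbT; apply/andP; split.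
    - by apply/eqP => ca; apply: nZ; right; left.
    - by apply/eqP => ca; apply: nZ; right; right.
  have [v dv vC] : exists2 v, is_derive c 1 phi v & `|v| <= C.
    by apply: contrapT => H; apply: nZ; left => /(_ abc).
  have [g g0 gP] := derivative_bound_local_increment dv vC e'0.
  exists g => // s t /andP[as_ sc] gs /andP[ct tb] tg.
  move=> [N [l [r [lr disj len incr]]]].
  exists N, l, r; split => //.
  - by move=> i iN; have [? ? ?] := lr i iN; split => //; lra.
  - apply: (le_trans len); apply: le_measure; rewrite ?inE.
    + by apply: measurableI; [exact: open_measurable|exact: measurable_itv].
    + by apply: measurableI; [exact: open_measurable|exact: measurable_itv].
    + move=> z /= [Uz]; rewrite !in_itv /= => /andP[az zs].
      by split => //; apply/andP; split => //; lra.
  - have -> : phi t - phi a = (phi s - phi a) + (phi t - phi s).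
      by rewrite [RHS]addrC addrA subrK.
    rewrite (le_trans (ler_normD _ _)) //.
    rewrite (le_trans (lerD incr (gP s t gs sc ct tg))) //.
    by rewrite addrAC -mulrDr (addrC (s - a)) addrA subrK.
have var : \sum_(i < N) `|phi (r i) - phi (l i)| < e / 2.
  apply: (smallvar N (fun i => l i) (fun i => r i)) => [i||].
  - exact: lr.
  - exact: ordered_intervals_disjoint.
  - rewrite -lte_fin (le_lt_trans len) // (le_lt_trans _ muU) //.
    apply: le_measure; rewrite ?inE //.
    + by apply: measurableI; [exact: open_measurable|exact: measurable_itv].
    + exact: open_measurable.
have small : e' * (b - a) <= e / 2.
  by rewrite /e' mulrAC ler_pdivrMr; [apply: ler_wpM2l; lra | lra].
rewrite (le_trans incr) // mulrDl -addrA lerD //; lra.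
Qed.

(** * Growth of absolutely continuous functions *)

Lemma abs_continuous_onS (R : realType) (V : normedModType R)
    (a b a' b' : R) (x : R -> V) :
  a <= a' -> b' <= b -> abs_continuous_on a b x -> abs_continuous_on a' b' x.
Proof.
move=> aa' bb' acx e e0; have [delta delta0 small] := acx e e0.
exists delta => // N l r lr; apply: small => i.
by have [? ? ?] := lr i; split => //; lra.
Qed.

Lemma abs_continuous_onB (R : realType) (V : normedModType R)
    (a b : R) (x y : R -> V) :
  abs_continuous_on a b x -> abs_continuous_on a b y ->
  abs_continuous_on a b (x - y).
Proof.
move=> acx acy e e0; have e2 : 0 < e / 2 by lra.
have [dx dx0 smallx] := acx _ e2; have [dy dy0 smally] := acy _ e2.
exists (Num.min dx dy); first by rewrite lt_min dx0.
move=> N l r lr disj; rewrite lt_min => /andP[lenx leny].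
rewrite [e]splitr (le_lt_trans _ (ltrD (smallx N l r lr disj lenx)
  (smally N l r lr disj leny))) // -big_split ler_sum // => i _.
have -> : (x - y) (r i) - (x - y) (l i)
        = (x (r i) - x (l i)) - (y (r i) - y (l i)).
  by rewrite -![(x - y) _]/(x _ - y _) !opprD !opprK addrACA.
exact: ler_normB.
Qed.

Lemma abs_continuous_uniformly (R : realType) (V : normedModType R)
    (a b e : R) (x : R -> V) :
  abs_continuous_on a b x -> 0 < e ->
  exists2 delta, 0 < delta & forall s t, a <= s -> s <= t -> t <= b ->
    t - s < delta -> `|x t - x s| < e.
Proof.
move=> acx e0; have [delta delta0 small] := acx e e0.
exists delta => // s t as_ st tb ts.
have := small 1%N (fun=> s) (fun=> t).
by rewrite !big_ord1; apply => // i j _ _ _; rewrite !ord1.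
Qed.

(** A short-time form of Gronwall's inequality.  The derivative bound is
    available only while [w] remains below [e]; there it keeps [w] within
    [`|w s| + e / 2 < e], with a margin that uniform continuity turns into a
    further stretch of time.  This lets a Lipschitz bound valid only near
    a reference trajectory control the trajectories that start close to it. *)
Lemma abs_continuous_stays_small (R : realType) (V : normedModType R)
    (s t L e : R) (w : R -> V) :
  s <= t -> 0 <= L -> L * (t - s) <= 1 / 2 -> 0 < e ->
  abs_continuous_on s t w -> `|w s| < e / 2 ->
  {ae lebesgue_measure, forall u : R, s < u < t -> `|w u| < e ->
     exists2 v, is_derive u 1 w v & `|v| <= L * e} ->
  `|w t| < e.
Proof.
move=> st L0 Lts e0 acw ws dw.
(* The margin that remains after the growth by at most [e / 2]. *)
have gap0 : 0 < e / 2 - `|w s| by lra.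
have [delta delta0 unif] := abs_continuous_uniformly acw gap0.
suff : forall z, s <= z <= t -> `|w z| < e by apply; rewrite st lexx.
apply: (@real_induction R s t
  (fun u => forall z, s <= z <= u -> `|w z| < e)) => //.
  by move=> z; rewrite -eq_le => /eqP <-; lra.
move=> c _; exists (delta / 2); first lra.
move=> u v /andP[su uc] cu /andP[cv vt] vc smallu z /andP[sz zv].
have [zu|uz] := leP z u; first by apply: smallu; rewrite sz.
have wu : `|w u - w s| <= L * e * (u - s).
  apply: abs_continuous_increment_le => //; first by rewrite mulr_ge0 // ltW.
    by apply: abs_continuous_onS acw => //; lra.
  apply: negligibleS dw => r /= ndwr dwr; apply: ndwr => /andP[sr ru].
  by apply: dwr; [rewrite sr; lra | apply: smallu; lra].
have wz : `|w z - w u| < e / 2 - `|w s| by apply: unif; lra.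
have Lus : L * e * (u - s) <= e / 2.
  have : L * (u - s) <= L * (t - s) by apply: ler_wpM2l => //; lra.
  by nra.
have -> : w z = (w z - w u) + (w u - w s) + w s by rewrite !addrA !subrK.
have := ler_normD ((w z - w u) + (w u - w s)) (w s).
have := ler_normD (w z - w u) (w u - w s).
lra.
Qed.

(** * Lipschitz bounds uniform in the disturbance *)

(** The tube lemma for [{p} * D].  One parameter [C] serves as bound and as
    inverse radius, so that compactness is used along the filter at infinity and
    finitely many such statements can be combined. *)
Lemma locally_bounded_near_compact (R : realType) (U V W : normedModType R)
    (h : U * V -> W) (p : U) (D : set V) :
  compact D -> (forall d, D d -> {for (p, d), continuous h}) ->
  \forall C \near +oo, forall d, D d ->
    forall x, `|x - p| < C^-1 -> `|h (x, d)| <= C.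
Proof.
move=> /compact_near_coveringP cD hc.
apply: (cD R +oo (fun C d => forall x, `|x - p| < C^-1 -> `|h (x, d)| <= C)).
move=> d Dd; have /cvgrPdist_lt/(_ 1 ltr01) := hc d Dd.
move=> /nbhs_ballP[r /= r0 near_r].
exists (ball d r, [set C | Num.max (r^-1) (`|h (p, d)| + 1) <= C]).
  split; first exact: nbhsx_ballx.
  by apply: nbhs_pinfty_ge; rewrite num_real.
move=> [d' C] [/= dd']; rewrite ge_max => /andP[rC hC] x xp.
have C0 : 0 < C by apply: lt_le_trans rC; rewrite invr_gt0.
have xr : ball (p, d) r (x, d').
  split => //=; rewrite -ball_normE /ball_ /= distrC (lt_le_trans xp) //.
  by rewrite -[leRHS]invrK lef_pV2 // posrE invr_gt0.
have := near_r _ xr; rewrite /= distrC => hxd.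
rewrite (le_trans _ hC) // -[h (x, d')](subrK (h (p, d))).
by rewrite (le_trans (ler_normD _ _)) // addrC lerD2l ltW.
Qed.

Lemma cV_dist_ltP (R : realType) (n : nat) (p y : 'cV[R]_n) (r : R) : 0 < r ->
  `|y - p| < r <-> forall i, `|y i 0 - p i 0| < r.
Proof.
move=> r0; rewrite distrC -[X in X <-> _]/(ball_ Num.norm p r y) -mx_norm_ball.
split=> [[_ yp] i|yp].
  by rewrite distrC; exact: (yp i 0).
by split => // i j; rewrite (ord1 j) /ball /= distrC.
Qed.

Lemma cV_entry_le_norm (R : realType) (n : nat) (y : 'cV[R]_n) (i : 'I_n) :
  `|y i 0| <= `|y|.
Proof.
rewrite leNgt; apply/negP => yi.
have y0 : 0 < `|y i 0| by rewrite (le_lt_trans _ yi).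
have /(cV_dist_ltP 0 y y0) : `|y - 0| < `|y i 0| by rewrite subr0.
by move=> /(_ i); rewrite mxE subr0 ltxx.
Qed.

(** Replacing the coordinates of [u] by those of [w] one at a time stays in the
    ball because the norm is the supremum norm, and each replacement moves along
    a basis vector by at most [`|w - u|]. *)
Lemma coordinatewise_lipschitz (R : realType) (n : nat) (W : normedModType R)
    (F : 'cV[R]_n -> W) (p : 'cV[R]_n) (r C : R) :
  0 < r -> 0 <= C ->
  (forall x j, `|x - p| < r ->
     derivable F x (delta_mx j 0) /\ `|'D_(delta_mx j 0) F x| <= C) ->
  forall u w, `|u - p| < r -> `|w - p| < r ->
    `|F w - F u| <= n%:R * C * `|w - u|.
Proof.
move=> r0 C0 dF u w /(cV_dist_ltP _ _ r0) up /(cV_dist_ltP _ _ r0) wp.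
pose z (k : nat) : 'cV[R]_n := \col_i (if (i < k)%N then w i 0 else u i 0).
have z0 : z 0%N = u by apply/matrixP => i j; rewrite mxE ltn0 (ord1 j).
have zn : z n = w by apply/matrixP => i j; rewrite mxE ltn_ord (ord1 j).
suff bound k : (k <= n)%N -> `|F (z k) - F u| <= k%:R * C * `|w - u|.
  by have := bound n (leqnn n); rewrite zn.
elim: k => [_|k IH kn]; first by rewrite z0 subrr normr0 !mul0r.
pose j := Ordinal kn; pose e : 'cV[R]_n := delta_mx j 0.
pose c := w j 0 - u j 0.
have zS : z k.+1 = z k + c *: e.
  apply/matrixP => i l; rewrite (ord1 l) !mxE eqxx andbT ltnS leq_eqVlt.
  have [->|ij] := eqVneq i j; first by rewrite eqxx ltnn mulr1 addrC subrK.
  have -> : (i == k :> nat) = false by apply/negbTE; apply: contra ij.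
  by rewrite mulr0 addr0.
have close s : `|z k j 0 + s - p j 0| < r -> `|z k + s *: e - p| < r.
  move=> sj; apply/(cV_dist_ltP _ _ r0) => i.
  have [->|ij] := eqVneq i j.
    by move: sj; rewrite !mxE !eqxx mulr1.
  by rewrite !mxE (negPf ij) mulr0 addr0; case: ifP.
have zkj : z k j 0 = u j 0 by rewrite mxE ltnn.
have step : `|F (z k.+1) - F (z k)| <= C * `|c|.
  have := up j; have := wp j; rewrite !ltr_norml => /andP[w1 w2] /andP[u1 u2].
  rewrite zS; have [c0|c0] := leP 0 c.
    rewrite ger0_norm //; apply: directional_increment_le => // s /andP[s0 sc].
    apply: dF; apply: close; rewrite zkj ltr_norml.
    by rewrite /c in sc; apply/andP; split; lra.
  (* For [c < 0] the same segment is run from its other end. *)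
  rewrite ltr0_norm // distrC -{1}[z k](addrK (c *: e)) -scaleNr.
  apply: directional_increment_le => [|s /andP[s0 sc]]; first lra.
  apply: dF; rewrite -[z k + _ + _]addrA -scalerDl; apply: close.
  rewrite zkj ltr_norml; by rewrite /c in sc c0 *; apply/andP; split; lra.
have cwu : `|c| <= `|w - u|.
  by have := cV_entry_le_norm (w - u) j; rewrite !mxE.
rewrite -(subrK (F (z k)) (F (z k.+1))) -addrA (le_trans (ler_normD _ _)) //.
rewrite -natr1 !mulrDl mul1r [leRHS]addrC lerD ?IH 1?ltnW //.
by rewrite (le_trans step) // ler_wpM2l.
Qed.

Lemma partial_derivative (R : realType) (U V W : normedModType R)
    (F : U * V -> W) (x : U) (d : V) (v : U) :
  derivable (fun y => F (y, d)) x v = derivable F (x, d) (v, 0) /\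
  'D_v (fun y => F (y, d)) x = 'D_(v, 0) F (x, d).
Proof.
rewrite /derivable /derive.
have -> :
    (fun h : R =>
       h^-1 *: (((fun y => F (y, d)) \o shift x) (h *: v) - F (x, d)))
  = (fun h : R =>
       h^-1 *: ((F \o shift (x, d)) (h *: (v, 0 : V)) - F (x, d))).
  apply/funext => h /=; congr (_ *: (F _ - _)).
  by rewrite -[_ *: (v, 0)]/(h *: v, h *: 0) scaler0 -[RHS]/(_, _) add0r.
by [].
Qed.

(** Joint continuity of the partial derivatives in [x] bounds them near
    [{p} * D], uniformly in [d] by compactness of [D]. *)
Lemma locally_lipschitz_uniformly (R : realType) (n m : nat)
    (f : 'cV[R]_n -> 'cV[R]_m -> 'cV[R]_n) (D : set 'cV[R]_m) (p : 'cV[R]_n) :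
  compact D ->
  (forall j x d, D d ->
     derivable (fun z => f z.1 z.2) (x, d) (delta_mx j 0 : 'cV[R]_n, 0) /\
     {for (x, d), continuous
        ('D_(delta_mx j 0 : 'cV[R]_n, 0 : 'cV[R]_m) (fun z => f z.1 z.2))}) ->
  exists r L : R, [/\ 0 < r, 0 <= L &
    forall d u w, D d -> `|u - p| < r -> `|w - p| < r ->
      `|f w d - f u d| <= L * `|w - u|].
Proof.
move=> cD smooth.
pose DF (j : 'I_n) :=
  'D_(delta_mx j 0 : 'cV[R]_n, 0 : 'cV[R]_m) (fun z => f z.1 z.2).
have bounded : \forall C \near (+oo : set_system R), forall j d, D d ->
    forall x, `|x - p| < C^-1 -> `|DF j (x, d)| <= C.
  apply: filter_forall => j; apply: locally_bounded_near_compact => // d Dd.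
  by have [] := smooth j p d Dd.
have [C [C0 DFC]] : exists C : R, 0 < C /\ forall j d, D d ->
    forall x, `|x - p| < C^-1 -> `|DF j (x, d)| <= C.
  by apply: (@filter_ex _ (+oo : set_system R)); near=> C; split; near: C;
    [exact: nbhs_pinfty_gt | exact: bounded].
exists C^-1, (n%:R * C).
split; [by rewrite invr_gt0 | by rewrite mulr_ge0 // ltW |].
move=> d u w Dd.
apply: (@coordinatewise_lipschitz _ _ _ (f ^~ d));
  [by rewrite invr_gt0 | exact: ltW |].
move=> x j xp; have [derF _] := smooth j x d Dd; have DFxd := DFC j d Dd x xp.
have [dfE ->] := partial_derivative (fun z => f z.1 z.2) x d (delta_mx j 0).
by split; [rewrite dfE | exact: DFxd].
Unshelve. all: by end_near.
Qed.

(** * Continuous dependence and closedness *)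

(** Real induction on the time up to which the dependence is known.  Near time
    [c] the reference curve stays in a ball around [x c] on which the right-hand
    side is Lipschitz, and on a time step short against the Lipschitz constant
    a neighbouring curve cannot drift off. *)
Lemma solutions_depend_continuously (R : realType) (n m : nat)
    (f : 'cV[R]_n -> 'cV[R]_m -> 'cV[R]_n) (t0 : R) (D : set 'cV[R]_m)
    (d : R -> 'cV[R]_m) (x0 : 'cV[R]_n) (x : R -> 'cV[R]_n) (t e : R) :
  (forall p, exists r L : R, [/\ 0 < r, 0 <= L &
     forall d u w, D d -> `|u - p| < r -> `|w - p| < r ->
       `|f w d - f u d| <= L * `|w - u|]) ->
  disturbances t0 D d -> is_integral_curve f t0 d x0 x -> t0 <= t -> 0 < e ->
  exists2 delta, 0 < delta & forall y0 y, is_integral_curve f t0 d y0 y ->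
    `|y0 - x0| < delta -> `|y t - x t| < e.
Proof.
move=> lip [_ dD] [xt0 acx dx] t0t.
pose stable s := forall e : R, 0 < e -> exists2 delta, 0 < delta &
  forall y0 y, is_integral_curve f t0 d y0 y ->
    `|y0 - x0| < delta -> `|y s - x s| < e.
suff : stable t by apply.
apply: (real_induction t0t) => {e}.
  by move=> e e0; exists e => // y0 y [yt0 _ _]; rewrite yt0 xt0.
move=> c /andP[t0c ct].
have [r [L [r0 L0 lipc]]] := lip (x c).
have [delta delta0 unif] :=
  abs_continuous_uniformly (acx t t0t) (divr_gt0 r0 (ltr0Sn _ 1)).
(* [k] makes [L] times a step shorter than [2 * k] at most [1 / 2]; the [+ 1]
   covers [L = 0]. *)
pose k := (4 * (L + 1))^-1.
have k0 : 0 < k by rewrite invr_gt0; lra.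
have kE : L * k + k = 1 / 4.
  by rewrite /k; field; apply: lt0r_neq0; lra.
exists (Num.min delta k); first by rewrite lt_min delta0.
move=> s u /andP[t0s sc].
rewrite ltrBlDr -ltrBlDl lt_min => /andP[cs_delta cs_k].
move=> /andP[cu ut]; rewrite -ltrBlDl lt_min => /andP[uc_delta uc_k].
move=> stable_s e e0.
(* Below [r / 2] the neighbouring curve stays in the ball of radius [r]. *)
pose e' := Num.min e (r / 2).
have e'0 : 0 < e' by rewrite lt_min e0 /=; lra.
have e'r : e' <= r / 2 by rewrite ge_min lexx orbT.
have [eta eta0 close_s] := stable_s (e' / 2) (divr_gt0 e'0 (ltr0Sn _ 1)).
exists eta => // y0 y curve_y y0x0.
have [_ acy dy] := curve_y.
suff : `|(y - x) u| < e' by move=> /lt_le_trans; apply; rewrite ge_min lexx.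
have su : s <= u by lra.
apply: (abs_continuous_stays_small su L0 _ e'0).
- have : L * (u - s) <= L * (2 * k) by apply: ler_wpM2l => //; lra.
  by lra.
- apply: (@abs_continuous_onS _ _ t0 t) => //.
  by apply: abs_continuous_onB; [exact: acy | exact: acx].
- exact: close_s curve_y y0x0.
apply: negligibleS (negligibleU dx dy) => v /= bad.
apply: contrapT => /not_orP[/contrapT dxv /contrapT dyv]; apply: bad.
move=> /andP[sv vu] small.
have t0v : t0 < v by lra.
exists (f (y v) (d v) - f (x v) (d v)).
  exact: (is_deriveB (dyv t0v) (dxv t0v)).
have xv : `|x v - x c| < r / 2.
  have [cv|vc] := leP c v; first by apply: unif => //; lra.
  by rewrite distrC; apply: unif; lra.
have yv : `|y v - x c| < r.
  rewrite -(subrK (x v) (y v)) -addrA (le_lt_trans (ler_normD _ _)) //.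
  by move: small; rewrite -[(y - x) v]/(y v - x v); lra.
rewrite (le_trans (lipc (d v) (x v) (y v) (dD v (ltW t0v)) _ yv));
  [by [] | lra |].
by rewrite ler_wpM2l // ltW.
Qed.

Theorem proposition2 (R : realType) (n m p : nat)
  (f : 'cV[R]_n -> 'cV[R]_m -> 'cV[R]_n) (g : 'I_p -> 'cV[R]_n -> R)
  (t0 : R) (D : set 'cV[R]_m)
  (A1_compact : compact D) (A1_convex : convex_set D)
  (A2 : exists E : set 'cV[R]_m, [/\ open E, D `<=` E,
     Ck_along 2 [set v : 'cV[R]_n * 'cV[R]_m | v.1 = 0] [set z | E z.2]
       (fun z => f z.1 z.2) &
     Ck_along 2 [set v : 'cV[R]_n * 'cV[R]_m | v.2 = 0] [set z | E z.2]
       (fun z => f z.1 z.2)])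
  (A3 : forall (x0 : 'cV[R]_n) (d : R -> 'cV[R]_m), disturbances t0 D d ->
     exists x : R -> 'cV[R]_n,
       [/\ is_integral_curve f t0 d x0 x,
           (forall T : R, t0 <= T -> bounded_set (x @` `[t0, T])) &
           (forall y : R -> 'cV[R]_n, is_integral_curve f t0 d x0 y ->
              forall t : R, t0 <= t -> y t = x t)])
  (A4 : forall x : 'cV[R]_n, convex_set (f x @` D))
  (A5_C2 : forall i : 'I_p, Ck_along 2 setT setT (g i))
  (A5_manifold : forall i : 'I_p, is_manifold [set x | g i x = 0]) :
  closed (maximal_RPI f t0 D (constraint_set g)).
Proof.
set M := maximal_RPI _ _ _ _.
have closedG : closed (constraint_set g).
  have -> : constraint_set g =
      \bigcap_(i in [set: 'I_p]) (g i @^-1` [set y | y <= 0]).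
    apply/seteqP; split => [x Gx i _|x Gx i]; first exact: Gx.
    exact: (Gx i I).
  apply: closed_bigI => i _; apply: closed_comp; last exact: closed_le.
  by move=> x _; have [gc _] := A5_C2 i; exact: gc.
have MG : M `<=` constraint_set g by move=> x [S [_ SG]] /SG.
have solutionP x0 d : disturbances t0 D d ->
    is_integral_curve f t0 d x0 (solution f t0 d x0).
  move=> /(A3 x0)[x [curve_x _ _]].
  exact: (xgetPex (cst x0) (ex_intro _ x curve_x)).
have lip q : exists r L : R, [/\ 0 < r, 0 <= L &
    forall d u w, D d -> `|u - q| < r -> `|w - q| < r ->
      `|f w d - f u d| <= L * `|w - u|].
  have [E [_ DE _ [_ dF]]] := A2.
  apply: locally_lipschitz_uniformly => // j x d Dd.
  have [derF [DFc _]] := dF (delta_mx j 0, 0) erefl.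
  split; first exact: (derF (x, d) (DE _ Dd)).
  exact: (DFc (x, d) (DE _ Dd)).
have RPI_M : RPI f t0 D M.
  move=> x0 d t [S [RPI_S SG] S_x0] dD t0t.
  by exists S => //; exact: RPI_S.
(* The closure of [M] is one of the invariant sets whose union is [M]. *)
move=> x clMx; exists (closure M) => //; split; last first.
  by rewrite ((closure_id (constraint_set g)).1 closedG); exact: closure_subset.
move=> x0 d t clMx0 dD t0t B /nbhs_ballP[e /= e0 eB].
have [delta delta0 near_x0] :=
  solutions_depend_continuously lip dD (solutionP x0 d dD) t0t e0.
have [y [My yx0]] := clMx0 _ (nbhsx_ballx x0 delta delta0).
exists (solution f t0 d y t); split; first exact: RPI_M.
apply: eB; rewrite -ball_normE /ball_ /= distrC.
apply: (near_x0 y); first exact: solutionP.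
by move: yx0; rewrite -ball_normE /ball_ /= distrC.
Qed.
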